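(* Let $\mathcal{G}$ be a connected bipartite graph with $s$ edges, whose (even) cycles $\mathcal{H}_1,\dots,\mathcal{H}_m$ have (pairwise) disjoint vertex sets. Let $X$ be the algebraic toric set associated to $\mathcal{G}$ over $K=\mathbb{F}_q$. Then $I(X)$ is generated by the union of the set $\{t_i^{q-1}-t_j^{q-1}:1\leq i,j\leq s\}$ with the set $I_1(X)\cup\cdots\cup I_m(X)$, where $I_i(X)=I(X)\cap S_i$ and $S_i\subset S=K[t_1,\dots,t_s]$ is the polynomial subring in the variables corresponding to the edges of $\mathcal{H}_i$.
   Context: $K=\mathbb{F}_q$ is a finite field with $q>2$ elements, $K^*=K\setminus\{0\}$, and $\mathbb{P}^{s-1}$ is the projective space of dimension $s-1$ over $K$. Graphs are simple, without isolated vertices and with at least two edges. For a graph $\mathcal{G}$ with vertices $v_1,\dots,v_n$ and edges $e_1,\dots,e_s$, for $\mathbf{x}\in(K^* )^n$ and $e_i=\{v_j,v_k\}$ put $\mathbf{x}^{e_i}=x_jx_k$. The algebraic toric set associated to $\mathcal{G}$ is $X=\{[(\mathbf{x}^{e_1},\dots,\mathbf{x}^{e_s})]:\mathbf{x}\in(K^* )^n\}\subset\mathbb{P}^{s-1}$, and $I(X)\subset S=K[t_1,\dots,t_s]$ is the ideal generated by the homogeneous polynomials vanishing on $X$; the variable $t_i$ corresponds to the edge $e_i$. Here $\mathcal{H}_1,\dots,\mathcal{H}_m$ are all the subgraphs of $\mathcal{G}$ that are cycles; $\mathcal{H}_i$ is isomorphic to an even cycle $\mathcal{C}_{2k_i}$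 of order $2k_i$. (The ideal $I_i(X)\subset S_i$ equals the vanishing ideal of the algebraic toric set associated to $\mathcal{H}_i$.) *)

(* Defs.v *)
From mathcomp Require Import all_boot all_order all_algebra.
From mathcomp Require Import mpoly.

Set Implicit Arguments.
Unset Strict Implicit.
Unset Printing Implicit Defensive.

Import GRing.Theory.
Local Open Scope ring_scope.

(* Simple graphs with vertices v_0, ..., v_(n-1) and edges e_0, ..., e_(s-1). *)
Record sgraph (n s : nat) := SGraph {
  edge :> 'I_s -> {set 'I_n};
  card_edge : forall i, #|edge i| = 2%N;
  edge_inj : injective edge
}.

Section Graph.
Variables (n s : nat) (G : sgraph n s).

(* Irreflexive, since #|G i| = 2 excludes G i = [set u; u]. *)
Definition adj : rel 'I_n := [rel u v | [exists i, G i == [set u; v]]].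

Definition no_isolated_vertex := forall v, exists i, v \in G i.

Definition connected_graph := forall u v, connect adj u v.

Definition bipartite :=
  exists A : {set 'I_n}, forall u v, adj u v -> (u \in A) != (v \in A).

(* A subgraph is given by its vertex set and the set of indices of its edges. *)
Definition subgraph : Type := ({set 'I_n} * {set 'I_s})%type.

Definition cycle_subgraph (H : subgraph) :=
  exists p : seq 'I_n,
    [/\ (2 < size p)%N, ucycle adj p, H.1 = [set x in p]
      & H.2 = [set i | [exists x in p, G i == [set x; next p x]]]].

Definition disjoint_cycles :=
  forall H H' : subgraph,
    cycle_subgraph H -> cycle_subgraph H' -> H <> H' -> [disjoint H.1 & H'.1].

End Graph.

(* The points of P^(s-1) are the lines of K^s. *)
Definition proj_space (K : fieldType) (s : nat) : Type :=
  {U : {vspace 'rV[K]_s} | \dim U == 1%N}.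

(* As v ranges over the homogeneous coordinates of P; only meaningful for f
   homogeneous, in which case one representative v is enough. *)
Definition vanishes_at (K : fieldType) (s : nat)
    (f : {mpoly K[s]}) (P : proj_space K s) :=
  forall v, v \in val P -> v != 0 -> f.@[fun i => v 0 i] = 0.

Definition ideal_gen (R : comNzRingType) (A : R -> Prop) : R -> Prop :=
  fun f => exists l : seq (R * R),
    (forall c, c \in l -> A c.2) /\ f = \sum_(c <- l) c.1 * c.2.

Section Toric.
Variables (K : finFieldType) (n s : nat) (G : sgraph n s).

(* [(x^e_0 : ... : x^e_(s-1))], where x^e_i = x_j x_k if e_i = {v_j, v_k}. *)
Definition toric_set : proj_space K s -> Prop :=
  fun P => exists x : 'I_n -> K,
    (forall j, x j != 0) /\
    val P = <[\row_(i < s) \prod_(j in G i) x j]>%VS.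

Definition vanishing_ideal (X : proj_space K s -> Prop) :
    {mpoly K[s]} -> Prop :=
  ideal_gen (fun f => (exists d, f \is d.-homog) /\
                      (forall P, X P -> vanishes_at f P)).

(* The subring of the polynomials in the variables 'X_i, i \in F. *)
Definition subring_in (F : {set 'I_s}) : {mpoly K[s]} -> Prop :=
  fun f => forall m, m \in msupp f -> forall i, i \notin F -> m i = 0%N.

End Toric.

(* Main.v *)
(* Write q = #|K|.  The characters of the torus of vectors in K^n without zero
   entries are orthogonal, so I(X) is spanned by the multiples of the binomials
   X^m - X^m' in which m and m' have the same degree and the entries of m - m'
   at the edges through any given vertex sum to 0 modulo q - 1.  With signs from
   the bipartition, m - m' is a flow modulo q - 1; it vanishes on the edges lying
   on no cycle, and since the cycles are disjoint it restricts to a flow on each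
   of them.  The binomial is then treated cycle by cycle: the restrictions of m
   and m' to a cycle have degrees congruent modulo q - 1, and give a binomial of
   I_k(X) after padding with a power of some X_j^(q-1). *)

Require Import Defs.
From mathcomp Require Import all_boot all_order all_algebra all_fingroup all_field.
From mathcomp Require Import mpoly ring zify.
From Stdlib Require Import Classical.

Set Implicit Arguments.
Unset Strict Implicit.
Unset Printing Implicit Defensive.

Import GRing.Theory.
Local Open Scope ring_scope.

(** * Generated ideals and congruence modulo them *)

Section IdealGen.
Variable R : comNzRingType.
Implicit Types (A B : R -> Prop) (f g h : R).

Lemma ideal_gen_mem A f : A f -> ideal_gen A f.
Proof.
move=> Af; exists [:: (1, f)]; split; last by rewrite big_seq1 mul1r.
by move=> c; rewrite inE => /eqP ->.
Qed.

Lemma ideal_gen0 A : ideal_gen A 0.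
Proof. by exists [::]; split=> //; rewrite big_nil. Qed.

Lemma ideal_genD A f g : ideal_gen A f -> ideal_gen A g -> ideal_gen A (f + g).
Proof.
move=> [l [Al ->]] [l' [Al' ->]]; exists (l ++ l'); split; last by rewrite big_cat.
by move=> c; rewrite mem_cat => /orP[/Al|/Al'].
Qed.

Lemma ideal_genM A f g : ideal_gen A g -> ideal_gen A (f * g).
Proof.
move=> [l [Al ->]]; exists [seq (f * c.1, c.2) | c <- l]; split.
  by move=> c /mapP[c' /Al Ac' ->].
by rewrite big_map mulr_sumr; apply: eq_bigr => c _; rewrite mulrA.
Qed.

Lemma ideal_gen_sum A (I : Type) (r : seq I) (P : pred I) (F : I -> R) :
  (forall i, P i -> ideal_gen A (F i)) -> ideal_gen A (\sum_(i <- r | P i) F i).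
Proof.
move=> AF; elim/big_rec: _ => [|i f Pi Af]; first exact: ideal_gen0.
by apply: ideal_genD => //; apply: AF.
Qed.

Lemma ideal_gen_sub A B f :
  (forall g, A g -> ideal_gen B g) -> ideal_gen A f -> ideal_gen B f.
Proof.
move=> AB [l [Al ->]]; rewrite big_seq; apply: ideal_gen_sum => c lc.
by apply: ideal_genM; apply: AB; apply: Al.
Qed.

Definition eq_mod A f g := ideal_gen A (f - g).

Lemma eq_mod_refl A f : eq_mod A f f.
Proof. by rewrite /eq_mod subrr; apply: ideal_gen0. Qed.

Lemma eq_mod_sym A f g : eq_mod A f g -> eq_mod A g f.
Proof. by move/(ideal_genM (-1)); rewrite mulN1r opprB. Qed.

Lemma eq_mod_trans A f g h : eq_mod A f g -> eq_mod A g h -> eq_mod A f h.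
Proof. by move=> fg /(ideal_genD fg); rewrite addrA subrK. Qed.

Lemma eq_modM A f g f' g' :
  eq_mod A f g -> eq_mod A f' g' -> eq_mod A (f * f') (g * g').
Proof.
move=> fg fg'; have := ideal_genD (ideal_genM f' fg) (ideal_genM g fg').
rewrite /eq_mod; congr ideal_gen; ring.
Qed.

Lemma eq_modX A f g k : eq_mod A f g -> eq_mod A (f ^+ k) (g ^+ k).
Proof.
move=> fg; elim: k => [|k IH]; first exact: eq_mod_refl.
by rewrite !exprS; apply: eq_modM.
Qed.

End IdealGen.

(** * Cycles and bridges of a graph *)

Lemma next_cons_last (T : eqType) (x : T) (p : seq T) :
  uniq (x :: p) -> next (x :: p) (last x p) = x.
Proof.
(* The last entry has index [size p] in [x :: p], so [next] looks past the end of [p] and returns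
   its default value [x]. *)
by move=> Up; rewrite next_nth mem_last index_last // nth_default.
Qed.

Section Graph.
Variables (n s : nat) (G : sgraph n s).

Lemma edgeP i : exists u v, u != v /\ G i = [set u; v].
Proof.
by have/eqP/cards2P[u [v [uv ->]]] := card_edge G i; exists u, v.
Qed.

Lemma closed_walk_cycle (u : 'I_n) (p : seq 'I_n) :
  (1 < size p)%N -> uniq (u :: p) -> path (adj G) u p ->
  forall i, G i = [set last u p; u] ->
  exists2 H, cycle_subgraph G H & i \in H.2.
Proof.
move=> szp Up Pp i Gi; set c := u :: p.
exists ([set x in c], [set i | [exists x in c, G i == [set x; next c x]]]).
  exists c; split=> //; apply/andP; split=> //=.
  by rewrite rcons_path Pp /=; apply/existsP; exists i; rewrite Gi.
rewrite inE; apply/existsP; exists (last u p).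
by rewrite mem_last next_cons_last // Gi eqxx.
Qed.

Lemma cycle_edge_sub H i v :
  cycle_subgraph G H -> i \in H.2 -> v \in G i -> v \in H.1.
Proof.
move=> [p [_ _ -> ->]]; rewrite !inE => /existsP[x /andP[px /eqP->]].
by rewrite !inE => /orP[] /eqP-> //; rewrite mem_next.
Qed.

Lemma cycle_edges_nonempty H :
  cycle_subgraph G H -> exists i, i \in H.2.
Proof.
move=> [[|x p] [// _ /andP[Cp _] _ ->]].
have /existsP[i Gi] := next_cycle Cp (mem_head x p).
by exists i; rewrite inE; apply/existsP; exists x; rewrite mem_head.
Qed.

Definition on_cycle i := exists2 H, cycle_subgraph G H & i \in H.2.

Definition adj_but i : rel 'I_n :=
  [rel u v | [exists j, (j != i) && (G j == [set u; v])]].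

(** A path avoiding [i], shortened until no vertex repeats, is closed by [i] into a cycle. *)
Lemma adj_but_connect_cycle i u v :
  G i = [set u; v] -> u != v -> connect (adj_but i) u v -> on_cycle i.
Proof.
move=> Gi uv /connectP[p0 Pp0 def_v]; subst v.
case: (shortenP Pp0) Gi uv => p Pp Up _ Gi uv.
apply: (closed_walk_cycle (u := u) (p := p)) => //; last by rewrite setUC.
(* A path of length one would be a second edge with the ends of [i], which [edge_inj] excludes. *)
- case: p Pp Up Gi uv => [|x [|y p]] //=; first by rewrite eqxx.
  move=> /andP[/existsP[j /andP[ji /eqP Gj]] _] _ Gi _.
  by case/eqP: ji; apply: (@edge_inj _ _ G); rewrite Gi.
- apply: sub_path Pp => x y /existsP[j /andP[_ Gj]].
  by apply/existsP; exists j.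
Qed.

(** * Flows on a bipartite graph *)

Section Flow.
Variables (R : pzRingType) (A : {set 'I_n}).
Hypothesis bipA : forall u v, adj G u v -> (u \in A) != (v \in A).

(** For a flow [a] on [B] the left side is 0, so each choice of the potential [phi] yields a linear
    relation between the edge values. *)
Lemma sum_vertex_edge (B : {set 'I_s}) (phi : 'I_n -> R) (a : 'I_s -> R) :
  \sum_v phi v * \sum_(i in B | v \in G i) a i =
  \sum_(i in B) (\sum_(v in G i) phi v) * a i.
Proof.
under eq_bigr => v _ do rewrite mulr_sumr.
rewrite (exchange_big_dep (mem B)) /=; last by move=> v i _ /andP[].
by apply: eq_bigr => i Bi; rewrite mulr_suml; apply: eq_bigl => v; rewrite Bi.
Qed.

Lemma sum_edge i u v (phi : 'I_n -> R) : G i = [set u; v] -> u != v ->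
  \sum_(w in G i) phi w = phi u + phi v.
Proof. by move=> -> uv; rewrite big_setU1 ?inE //= big_set1. Qed.

(* Summing the relations over the vertices of A counts every edge once. *)
Lemma flow_total (B : {set 'I_s}) (a : 'I_s -> R) :
  (forall v, \sum_(i in B | v \in G i) a i = 0) -> \sum_(i in B) a i = 0.
Proof.
move=> a0; have := sum_vertex_edge B (fun v => (v \in A)%:R) a.
rewrite big1 => [|v _]; last by rewrite a0 mulr0.
move=> E; rewrite [RHS]E; apply: eq_bigr => i _.
have [u [v [uv Gi]]] := edgeP i; rewrite (sum_edge _ Gi uv).
have /bipA : adj G u v by apply/existsP; exists i; rewrite Gi.
by case: (u \in A); case: (v \in A); rewrite // ?addr0 ?add0r mul1r.
Qed.

(* An edge on no cycle is a bridge: summing the relations, with signs given by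
   the bipartition, over one side of the cut leaves only this edge. *)
Lemma flow_bridge (a : 'I_s -> R) i :
  (forall v, \sum_(i | v \in G i) a i = 0) -> ~ on_cycle i -> a i = 0.
Proof.
move=> a0 niC; have [u [v [uv Gi]]] := edgeP i.
pose phi w : R := if connect (adj_but i) u w then (-1) ^+ (w \in A) else 0.
have := sum_vertex_edge setT phi a.
rewrite big1 => [|w _]; last first.
  by under eq_bigl do rewrite inE /=; rewrite a0 mulr0.
rewrite (bigD1 i) ?inE //= (sum_edge _ Gi uv) {1}/phi connect0 {1}/phi.
have -> : connect (adj_but i) u v = false.
  by apply/negP => /(adj_but_connect_cycle Gi uv).
rewrite addr0 big1 ?addr0 => [/esym|j /andP[_ ji]].
  by case: (u \in A); rewrite ?mulN1r ?mul1r // => /eqP; rewrite oppr_eq0 => /eqP.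
have [x [y [xy Gj]]] := edgeP j; rewrite (sum_edge _ Gj xy).
have /bipA Axy : adj G x y by apply/existsP; exists j; rewrite Gj.
have xyC : connect (adj_but i) x y.
  by apply: connect1; apply/existsP; exists j; rewrite ji Gj eqxx.
have yxC : connect (adj_but i) y x.
  by apply: connect1; apply/existsP; exists j; rewrite ji Gj setUC eqxx.
have -> : phi x + phi y = 0; last by rewrite mul0r.
rewrite /phi; have -> : connect (adj_but i) u x = connect (adj_but i) u y.
  by apply/idP/idP => /connect_trans; apply.
case: ifP => _; last by rewrite addr0.
by move: Axy; case: (x \in A); case: (y \in A); rewrite // ?addNr ?subrr.
Qed.

End Flow.

(** * Partition of the edges into blocks: the cycles and the single bridges *)

Definition block (B : {set 'I_s}) :=
  (exists2 H, cycle_subgraph G H & B = H.2) \/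
  (exists2 i, ~ on_cycle i & B = [set i]).

Lemma blockP i : exists2 B, block B & i \in B.
Proof.
have [[H cH Hi]|niC] := classic (on_cycle i).
  by exists H.2 => //; left; exists H.
by exists [set i]; rewrite ?inE //; right; exists i.
Qed.

Hypothesis cyclesG : disjoint_cycles G.

Lemma cycle_meet H H' v : cycle_subgraph G H -> cycle_subgraph G H' ->
  v \in H.1 -> v \in H'.1 -> H = H'.
Proof.
move=> cH cH' Hv H'v; apply: NNPP => /(cyclesG cH cH').
by move/disjoint_setI0/setP/(_ v); rewrite !inE Hv H'v.
Qed.

(** Two cycles through a common edge share its ends, so by disjointness they coincide. Together with
    [blockP], the blocks partition the edges. *)
Lemma block_meet B B' i : block B -> block B' -> i \in B -> i \in B' -> B = B'.
Proof.
move=> [[H cH ->]|[j jC ->]] [[H' cH' ->]|[j' j'C ->]].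
- move=> iH iH'; have [u [v [_ Gi]]] := edgeP i.
  have ui : u \in G i by rewrite Gi !inE eqxx.
  by rewrite (cycle_meet cH cH' (cycle_edge_sub cH iH ui) (cycle_edge_sub cH' iH' ui)).
- by move=> iH; rewrite inE => /eqP ij; case: j'C; exists H; rewrite // -ij.
- by rewrite inE => /eqP ij iH; case: jC; exists H'; rewrite // -ij.
- by rewrite !inE => /eqP <- /eqP <-.
Qed.

(* A vertex of a cycle H meets, outside H, only edges that lie on no cycle. *)
Lemma flow_block (R : pzRingType) (a : 'I_s -> R) B : bipartite G ->
  (forall v, \sum_(i | v \in G i) a i = 0) -> block B ->
  forall v, \sum_(i in B | v \in G i) a i = 0.
Proof.
move=> [A bipA] a0 [[H cH ->]|[j jC ->]] v; last first.
  apply: big1 => i /andP[]; rewrite inE => /eqP-> _.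
  exact: (flow_bridge bipA a0 jC).
have [Hv|Hv] := boolP (v \in H.1); last first.
  by apply: big1 => i /andP[Hi /(cycle_edge_sub cH Hi)]; rewrite (negPf Hv).
rewrite -[RHS](a0 v) [RHS](bigID (mem H.2)) /=.
rewrite [X in _ = _ + X]big1 ?addr0; first by apply: eq_bigl => i; rewrite andbC.
move=> i /andP[vi niH]; apply: (flow_bridge bipA a0) => -[H' cH' H'i].
by rewrite (cycle_meet cH cH' Hv (cycle_edge_sub cH' H'i vi)) H'i in niH.
Qed.

End Graph.

(** * Characters of the multiplicative group of [K] *)

Lemma natr_card_eq0 (K : finFieldType) : #|K|%:R = 0 :> K.
(* Lagrange's theorem in the additive group of [K]. *)
Proof. by rewrite -[LHS]FinRing.zmodXgE -cardsT cyclic.expg_cardG ?inE. Qed.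

Section Toric.
Variables (K : finFieldType) (n s : nat) (G : sgraph n s).
Hypothesis q_gt2 : (2 < #|K|)%N.

Local Notation Q := (#|K| - 1)%N.

(** ['Z_Q] is the ring of integers modulo [Q] only for [Q] greater than 1; below that it defaults to
    two elements. *)
Lemma Q_gt1 : (1 < Q)%N. Proof. by rewrite subn1 ltn_predRL. Qed.

Lemma expf_Q (x : K) : x != 0 -> x ^+ Q = 1.
Proof.
move=> x0; apply: (mulfI x0).
by rewrite mulr1 -exprS subn1 prednK ?expf_card // (ltn_trans _ q_gt2).
Qed.

Lemma expf_Zp (x : K) k : x != 0 -> x ^+ (k%:R : 'Z_Q) = x ^+ k.
Proof.
move=> x0; rewrite val_Zp_nat ?Q_gt1 // [in RHS](divn_eq k Q).
by rewrite exprD mulnC exprM expf_Q // expr1n mul1r.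
Qed.

(** Otherwise ['X^a - 'X^b] is nonzero of degree less than [Q] and has the [Q] nonzero elements of
    [K] as roots. *)
Lemma expf_Zp_inj (a b : 'Z_Q) :
  (forall y : K, y != 0 -> y ^+ a = y ^+ b) -> a = b.
Proof.
move=> yab; apply/eqP; apply: contraT => ab; have Q1 := Q_gt1.
have ltQ (c : 'Z_Q) : (c < Q)%N.
  by apply: leq_trans (ltn_ord c) _; rewrite Zp_cast.
pose p : {poly K} := 'X^a - 'X^b.
have p0 : p != 0.
  apply/eqP => /polyP/(_ a); rewrite !coefE eqxx.
  rewrite (_ : (_ == _) = false) ?subr0; last exact: negPf ab.
  by move/eqP; rewrite oner_eq0.
have szp : (size p <= Q)%N.
  by rewrite (leq_trans (size_polyD _ _)) // size_polyN !size_polyXn geq_max !ltQ.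
have := @max_poly_roots _ p (enum (predC1 (0 : K))) p0 _ (enum_uniq _).
rewrite -cardE cardC1 -subn1 ltnNge szp; apply.
apply/allP => y; rewrite mem_enum inE /= => y0.
by rewrite rootE !hornerE_comm !hornerXn yab ?subrr.
Qed.

(** Orthogonality: replacing [y] by [z * y] multiplies the sum by the character's value at [z],
    which is not 1 for a suitable [z] if [a] and [b] differ. If they agree, the sum counts the
    nonzero elements, and [q - 1] is [-1] in [K]. *)
Lemma sum_characters (a b : 'Z_Q) :
  \sum_(y : K | y != 0) y ^+ a / y ^+ b = - (a == b)%:R.
Proof.
have [->|ab] := eqVneq a b.
  rewrite (eq_bigr (fun _ => 1)) => [|y y0]; last by rewrite divff // expf_neq0.
  rewrite sumr_const cardC1 -subn1 natrB ?(ltn_trans _ q_gt2) //.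
  by rewrite natr_card_eq0 sub0r.
set S := \sum_(y | _) _; rewrite oppr0.
have [/existsP[z /andP[z0 zab]]|zE] :=
  boolP [exists z : K, (z != 0) && (z ^+ a != z ^+ b)]; last first.
  case/eqP: ab; apply: expf_Zp_inj => y y0; apply/eqP; apply: contraNT zE => yab.
  by apply/existsP; exists y; rewrite y0.
have ES : S = z ^+ a / z ^+ b * S.
  rewrite {1}/S (reindex_onto ( *%R z) ( *%R z^-1)) => [|y y0]; last first.
    by rewrite mulrA mulfV // mul1r.
  rewrite mulr_sumr; apply: eq_big => [y|y _].
    by rewrite mulf_eq0 (negPf z0) mulrA mulVf // mul1r eqxx andbT.
  by rewrite !exprMn invfM; ring.
apply/eqP; have /eqP : (z ^+ a / z ^+ b - 1) * S = 0 by rewrite mulrBl -ES mul1r subrr.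
rewrite mulf_eq0 => /orP[|//]; rewrite subr_eq0 => /eqP E.
by case/eqP: zab; rewrite -[RHS]mul1r -E divfK // expf_neq0.
Qed.

(** * Monomials on the torus and binomials in the vanishing ideal *)

Definition toric_vec (x : 'I_n -> K) : 'rV[K]_s :=
  \row_(i < s) \prod_(j in G i) x j.

(** The exponents of the character of the torus obtained by evaluating ['X_[m]] at [toric_vec x], as
    [toric_monomial] shows. *)
Definition weight (m : 'X_{1.. s}) : {ffun 'I_n -> 'Z_Q} :=
  [ffun v => \sum_(i | v \in G i) (m i)%:R].

Lemma weightD m m' : weight (m + m')%MM = weight m + weight m'.
Proof.
apply/ffunP => v; rewrite !ffunE -big_split; apply: eq_bigr => i _.
by rewrite mnmDE natrD.
Qed.

Lemma weight_mulQ m k : weight (m *+ (Q * k))%MM = 0.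
Proof.
apply/ffunP => v; rewrite !ffunE big1 // => i _.
by rewrite mulmnE mulnCA natrM pchar_Zp ?Q_gt1 // mul0r.
Qed.

Lemma toric_monomial (x : 'I_n -> K) (m : 'X_{1.. s}) : (forall j, x j != 0) ->
  \prod_i toric_vec x 0 i ^+ m i = \prod_j x j ^+ weight m j.
Proof.
move=> x0; transitivity (\prod_i \prod_(j in G i) x j ^+ m i).
  by apply: eq_bigr => i _; rewrite mxE prodrXl.
rewrite (exchange_big_dep predT) //=; apply: eq_bigr => j _.
rewrite prodrXr -expf_Zp // natr_sum.
by congr (_ ^+ nat_of_ord _); rewrite ffunE.
Qed.

Lemma toric_vec_neq0 (x : 'I_n -> K) : (0 < s)%N -> (forall j, x j != 0) ->
  toric_vec x != 0.
Proof.
move=> s0 x0; apply/eqP => /rowP/(_ (Ordinal s0)); rewrite !mxE => /eqP.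
by rewrite prodf_seq_eq0 => /hasP[j _ /andP[_]]; rewrite (negPf (x0 j)).
Qed.

Local Notation X := (toric_set (K := K) G).

Lemma toric_point (x : 'I_n -> K) : (0 < s)%N -> (forall j, x j != 0) ->
  exists2 P, X P & val P = <[toric_vec x]>%VS.
Proof.
move=> s0 x0; have dP : \dim <[toric_vec x]>%VS == 1%N.
  by rewrite dim_vline toric_vec_neq0.
by exists (exist (fun U : {vspace _} => \dim U == 1%N) _ dP) => //; exists x.
Qed.

(** At [c *: toric_vec x] the value of a monomial depends only on its degree and its weight. *)
Lemma binomial_vanishing m m' : mdeg m = mdeg m' -> weight m = weight m' ->
  vanishing_ideal X ('X_[m] - 'X_[m']).
Proof.
move=> dm wm; apply: ideal_gen_mem; split.
  exists (mdeg m); apply/dhomogP => r /msuppB_le.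
  by rewrite mem_cat !msuppX !inE => /orP[] /eqP ->.
move=> P [x [x0 PE]] v; rewrite PE => /vlineP[c ->] _.
have E r : 'X_[r].@[fun i => (c *: toric_vec x) 0 i] =
    c ^+ mdeg r * \prod_j x j ^+ weight r j.
  rewrite mevalX -toric_monomial // mdegE -prodrXr -big_split.
  by apply: eq_bigr => i _; rewrite mxE exprMn.
by rewrite rmorphB /= !E dm wm subrr.
Qed.

(** On the torus [f] is a combination of characters; dividing by the character [w] and summing over
    the torus isolates the coefficient of [w]. *)
Lemma vanishing_weight_sum d (f : {mpoly K[s]}) w : (0 < s)%N ->
  f \is d.-homog -> (forall P, X P -> vanishes_at f P) ->
  \sum_(m <- msupp f | weight m == w) f@_m = 0.
Proof.
move=> s0 df fX.
pose F (x : {ffun 'I_n -> K}) := f.@[fun i => toric_vec x 0 i] / \prod_j x j ^+ w j.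
have F0 (x : {ffun 'I_n -> K}) : x \in ffun_on (predC1 0) -> F x = 0.
  move=> /ffun_onP x0; have [P XP PE] := toric_point s0 x0.
  rewrite /F (fX P XP) ?mul0r ?toric_vec_neq0 //.
  by rewrite PE memv_line.
have E : \sum_(x in ffun_on (predC1 0)) F x = 0 by apply: big1.
have {E}: \sum_(m <- msupp f) f@_m * \prod_j (- (weight m j == w j)%:R : K) = 0.
  have FE (x : {ffun 'I_n -> K}) : x \in ffun_on (predC1 0) ->
      F x = \sum_(m <- msupp f) f@_m * \prod_j (x j ^+ weight m j / x j ^+ w j).
    move=> /ffun_onP x0; rewrite /F mevalE mulr_suml; apply: eq_bigr => m _.
    by rewrite (toric_monomial (x := x)) // -mulrA -prodfV -big_split.
  rewrite -[RHS]E (eq_bigr _ FE).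
  rewrite exchange_big /=; apply: eq_bigr => m _.
  rewrite -mulr_sumr; congr (_ * _).
  (* The sum over the torus of a product over coordinates is the product of the sums over single
     coordinates. *)
  rewrite -(bigA_distr_big (predC1 0)
    (fun j (y : K) => y ^+ weight m j / y ^+ w j)).
  by apply: eq_bigr => j _; rewrite -sum_characters.
(* For [m] of weight [w] each of the [n] coordinates contributes a factor [-1]; for other [m] some
   factor is 0. *)
move=> E; apply: (mulIf (_ : (-1) ^+ n != 0)); first by rewrite signr_eq0.
rewrite mul0r -[RHS]E mulr_suml [RHS](bigID (fun m => weight m == w)) /=.
rewrite [X in _ = _ + X]big1 ?addr0 => [|m wm]; last first.
  have [j wj] : exists j, weight m j != w j.
    apply/existsP; apply: contraNT wm => /existsPn wE.
    by apply/eqP/ffunP => j; apply/eqP; have := wE j; rewrite negbK.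
  by rewrite (bigD1 j) //= (negPf wj) oppr0 mul0r mulr0.
apply: eq_bigr => m /eqP ->; congr (_ * _).
by under eq_bigr do rewrite eqxx; rewrite prodr_const card_ord.
Qed.

(** The terms of [f] are grouped by weight, and within each class compared with one fixed monomial
    [m0]; homogeneity makes the degrees agree. *)
Lemma homog_vanishing_mod_binomials (J : {mpoly K[s]} -> Prop) d f :
  (0 < s)%N -> f \is d.-homog -> (forall P, X P -> vanishes_at f P) ->
  (forall m m', mdeg m = mdeg m' -> weight m = weight m' ->
     eq_mod J 'X_[m] 'X_[m']) ->
  ideal_gen J f.
Proof.
move=> s0 df fX JB; rewrite [f]mpolyE.
rewrite (partition_big weight predT) //=; apply: ideal_gen_sum => w _.
have [/hasP[m0 fm0 /eqP wm0]|/hasPn nw] :=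
  boolP (has (fun m => weight m == w) (msupp f)); last first.
  rewrite big_seq_cond big1; first exact: ideal_gen0.
  by move=> m /andP[/nw/negPf->].
(* Subtracting ['X_[m0]] from every monomial changes nothing, since the coefficients of the class
   sum to 0. *)
rewrite (_ : bigop _ _ _ = \sum_(m <- msupp f | weight m == w)
    (f@_m)%:MP * ('X_[m] - 'X_[m0])); last first.
  under [RHS]eq_bigr do rewrite mulrBr !mul_mpolyC.
  rewrite sumrB -[X in _ = _ - X]scaler_suml (vanishing_weight_sum w s0 df fX).
  by rewrite scale0r subr0.
rewrite big_seq_cond; apply: ideal_gen_sum => m /andP[fm /eqP wm].
apply: ideal_genM; apply: JB; last by rewrite wm wm0.
by move/dhomogP: df => df; rewrite (df _ fm) (df _ fm0).
Qed.

End Toric.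

(** * Reduction modulo the generators on a single block *)

Section Generators.
Variables (K : finFieldType) (n s : nat) (G : sgraph n s).
Hypotheses (q_gt2 : (2 < #|K|)%N) (G_bip : bipartite G).
Hypothesis G_cycles : disjoint_cycles G.

Local Notation Q := (#|K| - 1)%N.
Local Notation I := (vanishing_ideal (toric_set (K := K) G)).
Local Notation weight := (weight K G).

Definition toric_generator (g : {mpoly K[s]}) :=
  (exists i j : 'I_s, g = 'X_i ^+ Q - 'X_j ^+ Q) \/
  (exists H : subgraph n s, [/\ cycle_subgraph G H, I g & subring_in H.2 g]).

Local Notation "f ~ g" := (eq_mod toric_generator f g) (at level 70).

Definition restrict (B : {set 'I_s}) (m : 'X_{1.. s}) : 'X_{1.. s} :=
  [multinom (if i \in B then m i else 0)%N | i < s].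

Lemma restrictT m : restrict setT m = m.
Proof. by apply/mnmP => i; rewrite mnmE inE. Qed.

Lemma restrict0 m : restrict set0 m = 0%MM.
Proof. by apply/mnmP => i; rewrite mnmE inE mnm0E. Qed.

Lemma restrictD (B F : {set 'I_s}) m : B \subset F ->
  restrict F m = (restrict B m + restrict (F :\: B) m)%MM.
Proof.
move=> /subsetP BF; apply/mnmP => i; rewrite mnmDE !mnmE inE.
by have [/BF ->|_] /= := boolP (i \in B); rewrite ?addn0.
Qed.

Lemma mdeg_restrict B m : mdeg (restrict B m) = (\sum_(i in B) m i)%N.
Proof. by rewrite mdegE [RHS]big_mkcond; apply: eq_bigr => i _; rewrite mnmE. Qed.

Lemma weight_restrict B m v :
  weight (restrict B m) v = \sum_(i in B | v \in G i) (m i)%:R.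
Proof.
rewrite ffunE [RHS]big_mkcondl; apply: eq_bigr => i _.
by rewrite mnmE; case: ifP.
Qed.

(** The difference of [m] and [m'] modulo [Q] is a flow; [flow_block] restricts it to [B], and
    [flow_total] then compares the degrees. *)
Lemma block_balanced B m m' : block G B -> weight m = weight m' ->
  weight (restrict B m) = weight (restrict B m') /\
  (mdeg (restrict B m))%:R = (mdeg (restrict B m'))%:R :> 'Z_Q.
Proof.
move=> BB wE; pose a i : 'Z_Q := (m i)%:R - (m' i)%:R.
have a0 v : \sum_(i | v \in G i) a i = 0.
  by move/ffunP/(_ v): wE; rewrite !ffunE sumrB => ->; rewrite subrr.
have aB := flow_block G_cycles G_bip a0 BB; split.
  apply/ffunP => v; apply/eqP; rewrite -subr_eq0 !weight_restrict -sumrB.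
  exact/eqP/aB.
have [A bipA] := G_bip.
apply/eqP; rewrite -subr_eq0 !mdeg_restrict !natr_sum -sumrB.
exact/eqP/(flow_total bipA aB).
Qed.

Lemma powers_eq_mod (i j : 'I_s) k : 'X_i ^+ (Q * k) ~ 'X_j ^+ (Q * k).
Proof.
rewrite !exprM; apply: eq_modX; apply: ideal_gen_mem; left.
by exists i, j.
Qed.

Lemma block_reduce B m m' (i0 : 'I_s) k : block G B -> weight m = weight m' ->
  mdeg (restrict B m) = (mdeg (restrict B m') + Q * k)%N ->
  'X_[restrict B m] ~ 'X_[restrict B m'] * 'X_i0 ^+ (Q * k).
Proof.
move=> BB wE dE; have [wB _] := block_balanced BB wE.
(* The padding variable is first taken in [B], so that on a cycle the binomial stays in its subring;
   it is then exchanged for ['X_i0]. *)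
suff [j E] : exists j : 'I_s,
    'X_[restrict B m] ~ 'X_[restrict B m'] * 'X_j ^+ (Q * k).
  apply: (eq_mod_trans E); apply: eq_modM; first exact: eq_mod_refl.
  exact: powers_eq_mod.
case: BB wB dE => [[H cH ->]|[j jC ->]] wB dE.
  have [j Hj] := cycle_edges_nonempty cH; exists j.
  rewrite mpolyXn -mpolyXD; apply: ideal_gen_mem; right; exists H; split=> //.
    apply: (binomial_vanishing q_gt2).
      by rewrite mdegD mdegMn mdeg1 mul1n dE.
    by rewrite weightD weight_mulQ // addr0.
  move=> r /msuppB_le; rewrite mem_cat !msuppX !inE => /orP[] /eqP -> i niH.
    by rewrite mnmE (negPf niH).
  rewrite mnmDE mnmE (negPf niH) mulmnE mnm1E.
  by case: eqP niH => [<-|]; rewrite ?Hj.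
(* On a single edge both sides are powers of ['X_j] of the same degree, hence equal. *)
exists j; rewrite mpolyXn -mpolyXD.
rewrite (_ : restrict [set j] m = (restrict [set j] m' + U_(j) *+ (Q * k))%MM).
  exact: eq_mod_refl.
apply/mnmP => i; move: dE; rewrite !mdeg_restrict !big_set1 mnmDE mulmnE mnm1E.
rewrite !mnmE inE [j == i]eq_sym; case: eqP => [->|_] //.
by rewrite mul1n.
Qed.

(** * Assembling the blocks *)

Section Common.
Variable i0 : 'I_s.

(* Both monomials are reduced to a common one of lower degree, because powers of
   X_i0^Q can be split off modulo the ideal, but not divided out. *)
Definition common_reduction (r r' : 'X_{1.. s}) := exists u k k',
  [/\ 'X_[r] ~ 'X_[u] * 'X_i0 ^+ (Q * k), 'X_[r'] ~ 'X_[u] * 'X_i0 ^+ (Q * k'),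
      mdeg r = (mdeg u + Q * k)%N & mdeg r' = (mdeg u + Q * k')%N].

Lemma common_reductionC r r' : common_reduction r r' -> common_reduction r' r.
Proof. by move=> [u [k [k' [? ? ? ?]]]]; exists u, k', k. Qed.

Lemma common_reductionD r1 r1' r2 r2' :
  common_reduction r1 r1' -> common_reduction r2 r2' ->
  common_reduction (r1 + r2)%MM (r1' + r2')%MM.
Proof.
have XE u1 u2 k1 k2 : 'X_[u1 + u2] * 'X_i0 ^+ (Q * (k1 + k2)) =
    'X_[u1] * 'X_i0 ^+ (Q * k1) * ('X_[u2] * 'X_i0 ^+ (Q * k2)) :> {mpoly K[s]}.
  by rewrite mpolyXD mulnDr exprD; ring.
move=> [u1 [k1 [k1' [E1 E1' d1 d1']]]] [u2 [k2 [k2' [E2 E2' d2 d2']]]].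
exists (u1 + u2)%MM, (k1 + k2)%N, (k1' + k2')%N; split.
- by rewrite XE mpolyXD; apply: eq_modM.
- by rewrite XE mpolyXD; apply: eq_modM.
- by rewrite !mdegD d1 d2; lia.
- by rewrite !mdegD d1' d2'; lia.
Qed.

(** The restriction of lower degree serves as the common monomial; the degrees differ by a multiple
    of [Q]. *)
Lemma block_common B m m' : block G B -> weight m = weight m' ->
  common_reduction (restrict B m) (restrict B m').
Proof.
move=> BB; wlog le_d : m m' / (mdeg (restrict B m') <= mdeg (restrict B m))%N.
  move=> W wE; have [|/ltnW] := leqP (mdeg (restrict B m')) (mdeg (restrict B m)).
    by move/W; apply.
  by move/W => /(_ (esym wE))/common_reductionC.
move=> wE; have [_ /(congr1 (@nat_of_ord _))] := block_balanced BB wE.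
rewrite !val_Zp_nat ?Q_gt1 // => /eqP; rewrite eqn_mod_dvd // => /dvdnP[k dk].
have dE : mdeg (restrict B m) = (mdeg (restrict B m') + Q * k)%N.
  by rewrite mulnC -dk subnKC.
exists (restrict B m'), k, 0%N; split; rewrite ?muln0 ?addn0 //.
  exact: block_reduce.
by rewrite mulr1; apply: eq_mod_refl.
Qed.

(** The closure condition makes [F] a union of blocks; induction on its size removes one block, and
    the rest is again such a union because distinct blocks are disjoint. *)
Lemma union_common (F : {set 'I_s}) m m' :
  (forall B i, block G B -> i \in B -> i \in F -> B \subset F) ->
  weight m = weight m' -> common_reduction (restrict F m) (restrict F m').
Proof.
move=> + wE; have [k] := ubnP #|F|; elim: k F => // k IH F ltF Fcl.
have [->|[i iF]] := set_0Vmem F.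
  rewrite !restrict0; exists 0%MM, 0%N, 0%N.
  by split; rewrite ?muln0 ?mulr1 ?addn0 //; apply: eq_mod_refl.
have [B BB iB] := blockP G i; have BF := Fcl B i BB iB iF.
rewrite !(restrictD _ BF); apply: common_reductionD; first exact: block_common.
apply: IH => [|B' j BB' jB']; last first.
  rewrite inE => /andP[njB jF]; apply/subsetP => l lB'.
  rewrite inE (subsetP (Fcl B' j BB' jB' jF)) // andbT.
  by apply: contra njB => lB; rewrite -(block_meet G_cycles BB' BB lB' lB).
apply: leq_trans (_ : #|F| <= k)%N; last by [].
by apply: proper_card; apply/properP; split; [apply: subsetDl|exists i; rewrite ?inE ?iB].
Qed.

(** With all edges taken together, equal degrees force the two powers of ['X_i0] to coincide, so
    both monomials reduce to the same one. *)
Lemma binomial_eq_mod m m' : mdeg m = mdeg m' -> weight m = weight m' ->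
  'X_[m] ~ 'X_[m'].
Proof.
move=> dE wE; have [//|u [k [k' []]]] := @union_common setT m m' _ wE.
rewrite !restrictT => E E' d d'.
have kk' : k = k'.
  apply/eqP; rewrite -(eqn_pmul2l (ltnW (Q_gt1 q_gt2))).
  by rewrite -(eqn_add2l (mdeg u)) -d -d' dE.
by apply: (eq_mod_trans E); apply: eq_mod_sym; rewrite kk'.
Qed.

End Common.

End Generators.

Theorem theorem5p13 (K : finFieldType) (n s : nat) (G : sgraph n s)
    (q_gt2 : (2 < #|K|)%N) (s_gt1 : (1 < s)%N)
    (G_noisol : no_isolated_vertex G)
    (G_conn : connected_graph G) (G_bip : bipartite G)
    (G_cycles : disjoint_cycles G) :
  let I := vanishing_ideal (toric_set (K := K) G) in
  forall f : {mpoly K[s]},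
    I f <->
    ideal_gen (fun g : {mpoly K[s]} =>
      (exists i j : 'I_s, g = 'X_i ^+ (#|K| - 1) - 'X_j ^+ (#|K| - 1)) \/
      (exists H : subgraph n s,
         [/\ cycle_subgraph G H, I g & subring_in H.2 g])) f.
Proof.
move=> I f; have s_gt0 := ltnW s_gt1; split.
  apply: ideal_gen_sub => g [[d dg] gX].
  apply: (homog_vanishing_mod_binomials q_gt2 s_gt0 dg gX).
  exact: (binomial_eq_mod q_gt2 G_bip G_cycles (Ordinal s_gt0)).
apply: ideal_gen_sub => g [[i [j ->]]|[H [_ Ig _]]] //.
(* Both monomials have degree [Q] and weight 0; the factor 1 brings the exponent to the form
   required by [weight_mulQ]. *)
rewrite !mpolyXn -[(#|K| - 1)%N]muln1; apply: binomial_vanishing => //.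
  by rewrite !mdegMn !mdeg1.
by rewrite !weight_mulQ.
Qed.
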